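(* Let $X$ be a non-empty set. Let $\rho_N$ be the $(\cdot,{}^+)$-congruence on $M(X^*,X\cup\overline{X^*})$ generated by the union of the relations $\{(\overline{u},\overline{\lambda}\,\overline{u}) : u\in X^+\}$, $\{(x,x^+\overline{x}) : x\in X\}$ and $\{(\overline{u}\,\overline{v},(\overline{u}\,\overline{v})^+\overline{uv}) : u,v\in X^+\}$. Then $M(X^*,X\cup\overline{X^*})/\rho_N$ is an $X$-generated $F$-restriction semigroup. Consequently, $\rho_N=\rho$, where $\rho$ is the $(\cdot,{}^+)$-congruence on $M(X^*,X\cup\overline{X^*})$ such that $M(X^*,X\cup\overline{X^*})/\rho$ is $(X\cup\overline{X^*})$-canonically isomorphic to $\mathsf{FFR}(X)$, and thus $M(X^*,X\cup\overline{X^*})/\rho_N$ is $X$-canonically $(\cdot,{}^+,{}^{\mathfrak{m}},\lambda)$-isomorphic to $\mathsf{FFR}(X)$.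
   Context: A restriction semigroup is an algebra $(R;\cdot,{}^+)$ of type $(2,1)$ such that $(R;\cdot)$ is a semigroup and the identities $x^+x=x$, $x^+y^+=y^+x^+$, $(x^+y)^+=x^+y^+$, $xy^+=(xy)^+x$ hold. Its set of projections is $P(R)=\{s^+ : s\in R\}$. The natural partial order is $s\le t$ iff $s=et$ for some $e\in P(R)$. The congruence $\sigma$ is the minimum congruence identifying all projections: $s\mathrel{\sigma}t$ iff $es=et$ for some $e\in P(R)$. An $F$-restriction semigroup is a restriction semigroup in which every $\sigma$-class has a maximum element with respect to $\le$; the maximum element of the $\sigma$-class of $s$ is denoted $s^{\mathfrak{m}}$. It has a maximum projection, denoted $\lambda$, which is its unique left identity. $F$-restriction semigroups are regarded as algebras in the signature $(\cdot,{}^+,{}^{\mathfrak{m}},\lambda)$ of type $(2,1,1,0)$; they form a variety, and $\mathsf{FFR}(X)$ denotes the free $X$-generated object of this variety. An algebra $A$ is $X$-generated if it is equipped with an assignment map $\iota_A:X\to A$ whose image generates $A$ in its signature. A morphism $\varphi:A\to B$ of $X$-generated algebras is ($X$-)canonical if $\varphi\circ\iota_A=\iota_B$. $X^+$ and $X^*$ are the free semigroup and the free monoid on $X$; the identity of $X^*$ is denoted $\lambda$. $\overline{X^*}=\{\overline{u}:u\in X^*\}$ is a disjoint bijective copy of $X^*$. The monoid $X^*$ is $(X\cup\overline{X^*})$-generated via $x\mapsto x$, $\overline{u}\mapsto u$. The Cayley graph $\mathrm{Cay}(S,Y)$ of a $Y$-generated monoid $S$ has vertex set $S$ and labeled directed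 edges $(s,y,s[y]_S)$ from $s$ to $s[y]_S$ with label $y$, for $s\in S$, $y\in Y$, where $[y]_S$ is the image of $y$ in $S$. A subgraph is accessible if it contains the vertex $\lambda$ (the identity of $S$) and each of its vertices is reachable by a directed path in the subgraph from $\lambda$. $M(S,Y)$ is the restriction semigroup of all pairs $(\Gamma,s)$ where $\Gamma$ is a finite accessible subgraph of $\mathrm{Cay}(S,Y)$ with at least one edge and $s$ is a vertex of $\Gamma$, with $(A,s)(B,t)=(A\cup sB,st)$ and $(A,s)^+=(A,\lambda)$, where $sB$ is the left translate of $B$ by $s$. It is $Y$-generated as a restriction semigroup via $y\mapsto(\Gamma_y,[y]_S)$, where $\Gamma_y$ is the graph with the single edge $(\lambda,y,[y]_S)$ and its endpoints. Elements of $Y$ are identified with their images in $M(S,Y)$; thus $x$ and $\overline{u}$ denote the elements $(\Gamma_x,x)$ and $(\Gamma_{\overline{u}},u)$ of $M(X^*,X\cup\overline{X^*})$. $\mathsf{FFR}(X)$ is $(X\cup\overline{X^*})$-generated as a restriction semigroup via $x\mapsto x$ and $\overline{u}\mapsto u^{\mathfrak{m}}$ ($u\in X^*$ evaluated in $\mathsf{FFR}(X)$, with the empty word giving $\lambda$), and it is an $(X\cup\overline{X^*})$-canonical $(\cdot,{}^+)$-quotient of $M(X^*,X\cup\overline{X^*})$; $\rho$ is the kernel congruence of this canonical quotient morphism. The quotient $M(X^*,X\cup\overline{X^*})/\rho_N$ is regarded as $X$-generated via $x\mapsto$ the $\rho_N$-class of $x$. *)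

(* Defs.v *)
From HB Require Import structures.
From Stdlib Require Import Relation_Operators.
From mathcomp Require Import all_boot.
From mathcomp Require Import generic_quotient.
From mathcomp Require Import boolp classical_sets functions cardinality.

Set Implicit Arguments.
Unset Strict Implicit.
Unset Printing Implicit Defensive.

Import Algebra.
Local Open Scope classical_set_scope.
Local Open Scope quotient_scope.
Local Open Scope group_scope.

(* [rplus x] is x^+; the notation [x ^+ n] is taken by powers. *)

HB.mixin Record Semigroup_isRestriction R of Semigroup R := {
  rplus : R -> R;
  rplus_mull : forall x : R, rplus x * x = x;
  rplusC : forall x y : R, rplus x * rplus y = rplus y * rplus x;
  rplus_mul : forall x y : R, rplus (rplus x * y) = rplus x * rplus y;
  mul_rplus : forall x y : R, x * rplus y = rplus (x * y) * x
}.

#[short(type="restrictionType")]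
HB.structure Definition Restriction :=
  {R of Semigroup_isRestriction R & Semigroup R}.

Definition projections (R : restrictionType) : set R := range (@rplus R).

Definition nle (R : restrictionType) (s t : R) : Prop :=
  exists2 e, projections e & s = e * t.

Definition is_maximum (R : restrictionType) (A : set R) (m : R) : Prop :=
  A m /\ forall t, A t -> nle t m.

Section RestrictionTheory.
Variable R : restrictionType.
Implicit Types s t e f : R.

Lemma rplus_idem s : rplus s * rplus s = rplus s.
Proof. by rewrite -rplus_mul rplus_mull. Qed.

Lemma rplus_id s : rplus (rplus s) = rplus s.
Proof.
by rewrite -{1}(rplus_idem s) rplus_mul rplusC rplus_mull.
Qed.

Lemma proj_rplus s : projections (rplus s). Proof. by exists s. Qed.

Lemma projP e : projections e <-> rplus e = e.
Proof.
split=> [[s _ <-]|<-]; [exact: rplus_id | exact: proj_rplus].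
Qed.

Lemma proj_idem e : projections e -> e * e = e.
Proof. by case=> s _ <-; exact: rplus_idem. Qed.

Lemma projC e f : projections e -> projections f -> e * f = f * e.
Proof. by move=> [s _ <-] [t _ <-]; exact: rplusC. Qed.

Lemma projM e f : projections e -> projections f -> projections (e * f).
Proof.
by move=> [s _ <-] [t _ <-]; exists (rplus s * t) => //; rewrite rplus_mul.
Qed.

Lemma proj_mul e s : projections e -> rplus (e * s) = e * rplus s.
Proof. by case=> t _ <-; exact: rplus_mul. Qed.

Lemma nleP s t : nle s t <-> s = rplus s * t.
Proof.
split=> [[e Pe st]|st]; last by exists (rplus s) => //; exact: proj_rplus.
rewrite {2}st proj_mul// -mulgA rplus_mull; exact: st.
Qed.

Lemma nle_anti s t : nle s t -> nle t s -> s = t.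
Proof.
move=> /nleP st /nleP ts.
by rewrite {1}st {1}ts mulgA rplusC -mulgA rplus_mull -ts.
Qed.

Lemma is_maximum_unique (A : set R) s t :
  is_maximum A s -> is_maximum A t -> s = t.
Proof. by move=> [As ms] [At mt]; apply: nle_anti; [apply: mt|apply: ms]. Qed.

End RestrictionTheory.

Record congruence (R : restrictionType) := Congruence {
  crel :> R -> R -> Prop;
  crel_refl : forall a, crel a a;
  crel_sym : forall a b, crel a b -> crel b a;
  crel_trans : forall a b c, crel a b -> crel b c -> crel a c;
  crel_mul : forall a a' b b', crel a a' -> crel b b' -> crel (a * b) (a' * b');
  crel_rplus : forall a a', crel a a' -> crel (rplus a) (rplus a')
}.

Section GeneratedCongruence.
Variables (R : restrictionType) (B : R -> R -> Prop).

Definition cgen_rel (a b : R) : Prop :=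
  forall rho : congruence R, (forall x y, B x y -> rho x y) -> rho a b.

Fact cgen_refl a : cgen_rel a a.
Proof. by move=> rho _; exact: crel_refl. Qed.

Fact cgen_sym a b : cgen_rel a b -> cgen_rel b a.
Proof. by move=> ab rho Brho; apply: crel_sym; apply: ab. Qed.

Fact cgen_trans a b c : cgen_rel a b -> cgen_rel b c -> cgen_rel a c.
Proof.
by move=> ab bc rho Brho; apply: (@crel_trans _ _ _ b); [apply: ab|apply: bc].
Qed.

Fact cgen_mul a a' b b' :
  cgen_rel a a' -> cgen_rel b b' -> cgen_rel (a * b) (a' * b').
Proof.
by move=> aa bb rho Brho; apply: crel_mul; [apply: aa|apply: bb].
Qed.

Fact cgen_rplus a a' : cgen_rel a a' -> cgen_rel (rplus a) (rplus a').
Proof. by move=> aa rho Brho; apply: crel_rplus; apply: aa. Qed.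

Definition cgen : congruence R :=
  Congruence cgen_refl cgen_sym cgen_trans cgen_mul cgen_rplus.

Lemma cgen_base x y : B x y -> cgen x y.
Proof. by move=> Bxy rho; exact. Qed.

End GeneratedCongruence.

Definition sigma (R : restrictionType) : congruence R :=
  cgen (fun e f : R => projections e /\ projections f).

Section Sigma.
Variable R : restrictionType.

Let srel (s t : R) : Prop := exists2 e, projections e & e * s = e * t.

Let srel_refl s : srel s s.
Proof. by exists (rplus s) => //; exact: proj_rplus. Qed.

Let srel_sym s t : srel s t -> srel t s.
Proof. by case=> e Pe E; exists e. Qed.

Let srel_trans s t u : srel s t -> srel t u -> srel s u.
Proof.
move=> [e Pe st] [f Pf tu]; exists (e * f); first exact: projM.
rewrite {1}(projC Pe Pf) -!mulgA st !mulgA (projC Pf Pe) -!mulgA.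
by rewrite tu.
Qed.

Let srel_mul s s' t t' : srel s s' -> srel t t' -> srel (s * t) (s' * t').
Proof.
move=> [e Pe ss] tt; apply: (@srel_trans _ (s' * t)).
  by exists e => //; rewrite !mulgA ss.
case: tt => f Pf tt; have /projP rf := Pf.
exists (rplus (s' * f)); first exact: proj_rplus.
have H u : rplus (s' * f) * (s' * u) = s' * (f * u).
  by rewrite mulgA -(mul_rplus s' f) rf mulgA.
by rewrite !H tt.
Qed.

Let srel_rplus s s' : srel s s' -> srel (rplus s) (rplus s').
Proof.
by move=> [e Pe ss]; exists e => //; rewrite -!proj_mul// ss.
Qed.

Lemma sigmaP (s t : R) :
  sigma R s t <-> exists2 e, projections e & e * s = e * t.
Proof.
split=> [|[e Pe st]].
- apply: (_ : sigma R s t -> Congruence srel_refl srel_sym srel_trans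
    srel_mul srel_rplus s t); apply => e f [Pe Pf].
  exists (e * f); first exact: projM.
  by rewrite -!mulgA (proj_idem Pf) (projC Pf Pe) mulgA (proj_idem Pe).
- move=> rho Brho.
  have rhoe u : rho (e * u) u.
    rewrite -{2}(rplus_mull u); rewrite -{1}(rplus_mull u) mulgA.
    apply: crel_mul; last exact: crel_refl.
    by apply: Brho; split; [apply: projM => //|]; exact: proj_rplus.
  apply: (crel_trans (crel_sym (rhoe s))); rewrite st; exact: rhoe.
Qed.

End Sigma.

Section Quotient.
Variables (R : restrictionType) (rho : congruence R).

Let crelb (a b : R) : bool := `[< rho a b >].

Fact crelb_equiv : equiv_class_of crelb.
Proof.
split.
- by move=> a; apply/asboolP; exact: crel_refl.
- by move=> a b; apply/asboolP/asboolP; exact: crel_sym.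
- move=> b a c /asboolP ab /asboolP bc; apply/asboolP; exact: crel_trans bc.
Qed.

Definition crel_equiv : equiv_rel R := EquivRelPack crelb_equiv.

Definition quot : Type := {eq_quot crel_equiv}.
HB.instance Definition _ := Choice.on quot.
HB.instance Definition _ := Quotient.on quot.

Definition class (a : R) : quot := \pi_quot a.

Lemma classP a b : class a = class b <-> rho a b.
Proof.
split=> [/eqmodP/asboolP//|ab]; apply/eqmodP/asboolP; exact: ab.
Qed.

Lemma class_surj (c : quot) : exists a, c = class a.
Proof. by exists (repr c); rewrite /class reprK. Qed.

Lemma repr_class a : rho (repr (class a)) a.
Proof. by apply/classP; rewrite /class reprK. Qed.

Definition quot_mul (c d : quot) : quot := class (repr c * repr d).
Definition quot_rplus (c : quot) : quot := class (rplus (repr c)).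

Lemma quot_mulE a b : quot_mul (class a) (class b) = class (a * b).
Proof. by apply/classP/crel_mul; exact: repr_class. Qed.

Lemma quot_rplusE a : quot_rplus (class a) = class (rplus a).
Proof. by apply/classP/crel_rplus; exact: repr_class. Qed.

Fact quot_mulA : associative quot_mul.
Proof.
move=> x y z; have [[[a ->] [b ->]] [c ->]] :=
  (class_surj x, class_surj y, class_surj z).
by rewrite !quot_mulE mulgA.
Qed.

HB.instance Definition _ := isSemigroup.Build quot quot_mulA.

Lemma classM a b : class (a * b) = class a * class b.
Proof. by rewrite -quot_mulE. Qed.

Fact quot_rplus_mull (x : quot) : quot_rplus x * x = x.
Proof.
by have [a ->] := class_surj x; rewrite quot_rplusE -classM rplus_mull.
Qed.

Fact quot_rplusC (x y : quot) :
  quot_rplus x * quot_rplus y = quot_rplus y * quot_rplus x.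
Proof.
have [[a ->] [b ->]] := (class_surj x, class_surj y).
by rewrite !quot_rplusE -!classM rplusC.
Qed.

Fact quot_rplus_mul (x y : quot) :
  quot_rplus (quot_rplus x * y) = quot_rplus x * quot_rplus y.
Proof.
have [[a ->] [b ->]] := (class_surj x, class_surj y).
by rewrite (quot_rplusE a) (quot_rplusE b) -!classM quot_rplusE rplus_mul.
Qed.

Fact quot_mul_rplus (x y : quot) : x * quot_rplus y = quot_rplus (x * y) * x.
Proof.
have [[a ->] [b ->]] := (class_surj x, class_surj y).
by rewrite (quot_rplusE b) -(classM a b) quot_rplusE -!classM mul_rplus.
Qed.

HB.instance Definition _ := Semigroup_isRestriction.Build quot
  quot_rplus_mull quot_rplusC quot_rplus_mul quot_mul_rplus.

Lemma class_rplus a : class (rplus a) = rplus (class a).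
Proof. by rewrite -quot_rplusE. Qed.

End Quotient.

(* [Fstruct R] says that [R] is an F-restriction semigroup.  Its two operations
   are determined by [R] ([is_maximum_unique]); [flamP] is not automatic only
   because the empty semigroup has no projection. *)

Record Fstruct (R : restrictionType) := FStruct {
  fmax : R -> R;
  flam : R;
  fmaxP : forall s, is_maximum (sigma R s) (fmax s);
  flamP : is_maximum (@projections R) flam
}.

Definition restr_morphism (R R' : restrictionType) (phi : R -> R') : Prop :=
  {morph phi : a b / a * b} /\ {morph phi : a / rplus a}.

Definition F_morphism (R R' : restrictionType) (fR : Fstruct R)
    (fR' : Fstruct R') (phi : R -> R') : Prop :=
  [/\ restr_morphism phi,
      forall a, phi (fmax fR a) = fmax fR' (phi a)
    & phi (flam fR) = flam fR'].

Definition canonical_map (Y A B : Type) (iA : Y -> A) (iB : Y -> B)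
    (phi : A -> B) : Prop :=
  forall y, phi (iA y) = iB y.

Definition canon_iso (Y : Type) (A B : restrictionType)
    (iA : Y -> A) (iB : Y -> B) : Prop :=
  exists phi : A -> B,
    [/\ restr_morphism phi, bijective phi & canonical_map iA iB phi].

Definition F_canon_iso (Y : Type) (A B : restrictionType) (fA : Fstruct A)
    (fB : Fstruct B) (iA : Y -> A) (iB : Y -> B) : Prop :=
  exists phi : A -> B,
    [/\ F_morphism fA fB phi, bijective phi & canonical_map iA iB phi].

Definition F_generated (Y : Type) (R : restrictionType) (fR : Fstruct R)
    (i : Y -> R) : Prop :=
  forall P : set R,
    (forall y, P (i y)) ->
    (forall a b, P a -> P b -> P (a * b)) ->
    (forall a, P a -> P (rplus a)) ->
    (forall a, P a -> P (fmax fR a)) ->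
    P (flam fR) ->
    forall r, P r.

(* Uniqueness of [phi] follows from [F_generated]. *)
Definition is_free_F (X : Type) (F : restrictionType) (fF : Fstruct F)
    (i : X -> F) : Prop :=
  F_generated fF i /\
  forall (R : restrictionType) (fR : Fstruct R) (f : X -> R),
    exists2 phi : F -> R, F_morphism fF fR phi & canonical_map i f phi.

(* Existence of the free object: terms modulo the identities that hold in all
   F-restriction semigroups. *)
Section FreeExists.
Variable X : Type.

Inductive term :=
| Var of X | Mul of term & term | Plus of term | Max of term | Lam.

HB.instance Definition _ := gen_eqMixin term.
HB.instance Definition _ := gen_choiceMixin term.

Fixpoint eval (R : restrictionType) (fR : Fstruct R) (f : X -> R)
    (t : term) : R :=
  match t with
  | Var x => f x
  | Mul t u => eval fR f t * eval fR f u
  | Plus t => rplus (eval fR f t)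
  | Max t => fmax fR (eval fR f t)
  | Lam => flam fR
  end.

Definition tvalid (t u : term) : Prop :=
  forall (R : restrictionType) (fR : Fstruct R) (f : X -> R),
    eval fR f t = eval fR f u.

Let tvalidb (t u : term) : bool := `[< tvalid t u >].

Fact tvalidb_equiv : equiv_class_of tvalidb.
Proof.
split.
- by move=> a; apply/asboolP.
- by move=> a b; apply/asboolP/asboolP => ab R fR f; rewrite ab.
- move=> b a c /asboolP ab /asboolP bc; apply/asboolP => R fR f.
  by rewrite ab bc.
Qed.

Definition tequiv : equiv_rel term := EquivRelPack tvalidb_equiv.

Definition ffr : Type := {eq_quot tequiv}.
HB.instance Definition _ := Choice.on ffr.
HB.instance Definition _ := Quotient.on ffr.

Let cl (t : term) : ffr := \pi_ffr t.

Let clP t u : cl t = cl u <-> tvalid t u.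
Proof.
split=> [/eqmodP/asboolP//|tu]; apply/eqmodP/asboolP; exact: tu.
Qed.

Let cl_repr c : cl (repr c) = c. Proof. by rewrite /cl reprK. Qed.

Let repr_cl t : tvalid (repr (cl t)) t.
Proof. by apply/clP; rewrite cl_repr. Qed.

Let cl_surj c : exists t, c = cl t.
Proof. by exists (repr c); rewrite cl_repr. Qed.

Let fm (c d : ffr) : ffr := cl (Mul (repr c) (repr d)).
Let fp (c : ffr) : ffr := cl (Plus (repr c)).
Let fx (c : ffr) : ffr := cl (Max (repr c)).

Let fmE t u : fm (cl t) (cl u) = cl (Mul t u).
Proof. by apply/clP => R fR f /=; rewrite !repr_cl. Qed.
Let fpE t : fp (cl t) = cl (Plus t).
Proof. by apply/clP => R fR f /=; rewrite !repr_cl. Qed.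
Let fxE t : fx (cl t) = cl (Max t).
Proof. by apply/clP => R fR f /=; rewrite !repr_cl. Qed.

Fact ffr_mulA : associative fm.
Proof.
move=> x y z; have [[[a ->] [b ->]] [c ->]] :=
  (cl_surj x, cl_surj y, cl_surj z).
by rewrite !fmE; apply/clP => R fR f /=; rewrite mulgA.
Qed.

HB.instance Definition _ := isSemigroup.Build ffr ffr_mulA.

Let mE t u : cl t * cl u = cl (Mul t u). Proof. exact: fmE. Qed.

Fact ffr_rplus_mull (x : ffr) : fp x * x = x.
Proof.
have [a ->] := cl_surj x; rewrite fpE mE; apply/clP => R fR f /=.
exact: rplus_mull.
Qed.

Fact ffr_rplusC (x y : ffr) : fp x * fp y = fp y * fp x.
Proof.
have [[a ->] [b ->]] := (cl_surj x, cl_surj y).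
by rewrite !fpE !mE; apply/clP => R fR f /=; exact: rplusC.
Qed.

Fact ffr_rplus_mul (x y : ffr) : fp (fp x * y) = fp x * fp y.
Proof.
have [[a ->] [b ->]] := (cl_surj x, cl_surj y).
by rewrite (fpE a) (fpE b) !mE fpE; apply/clP => R fR f /=; exact: rplus_mul.
Qed.

Fact ffr_mul_rplus (x y : ffr) : x * fp y = fp (x * y) * x.
Proof.
have [[a ->] [b ->]] := (cl_surj x, cl_surj y).
by rewrite (fpE b) (mE a b) fpE !mE; apply/clP => R fR f /=; exact: mul_rplus.
Qed.

HB.instance Definition _ := Semigroup_isRestriction.Build ffr
  ffr_rplus_mull ffr_rplusC ffr_rplus_mul ffr_mul_rplus.

Let pE t : rplus (cl t) = cl (Plus t). Proof. exact: fpE. Qed.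

Let le_fmax (R : restrictionType) (fR : Fstruct R) (s : R) :
  s = rplus s * fmax fR s.
Proof. by apply/nleP; apply: (fmaxP fR s).2; exact: crel_refl. Qed.

Let fmax_eq (R : restrictionType) (fR : Fstruct R) (s t : R) :
  sigma R s t -> fmax fR s = fmax fR t.
Proof.
move=> st; have [? ms] := fmaxP fR s; have [? mt] := fmaxP fR t.
apply: nle_anti; [apply: mt|apply: ms].
- exact: (crel_trans (crel_sym st)).
- exact: (crel_trans st).
Qed.

Fact ffr_fmaxP (s : ffr) : is_maximum (sigma ffr s) (fx s).
Proof.
have [a ->] := cl_surj s; rewrite fxE.
have le_max t : cl t = rplus (cl t) * cl (Max t).
  by rewrite pE mE; apply/clP => R fR f /=; exact: le_fmax.
split=> [|t].
  apply/sigmaP; exists (rplus (cl a)); first exact: proj_rplus.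
  by rewrite rplus_mull -le_max.
have [b ->] := cl_surj t; move=> /sigmaP[_ [c _ <-]].
have [{}c ->] := cl_surj c; rewrite pE !mE => /clP ab.
apply/nleP; rewrite {1}le_max; congr (_ * _); apply/clP => R fR f /=.
apply: fmax_eq; apply: crel_sym; apply/sigmaP.
exists (rplus (eval fR f c)); first exact: proj_rplus.
exact: (ab R fR f).
Qed.

Fact ffr_flamP : is_maximum (@projections ffr) (cl Lam).
Proof.
split=> [|_ [t _ <-]].
  apply/projP; rewrite pE; apply/clP => R fR f /=.
  by apply/projP; exact: (flamP fR).1.
have [a ->] := cl_surj t; rewrite pE; apply/nleP.
rewrite pE mE; apply/clP => R fR f /=.
by apply/nleP; apply: (flamP fR).2; exact: proj_rplus.
Qed.

Let ffr_struct := FStruct ffr_fmaxP ffr_flamP.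

Lemma free_F_exists :
  exists (F : restrictionType) (fF : Fstruct F) (i : X -> F), is_free_F fF i.
Proof.
exists ffr, ffr_struct, (fun x => cl (Var x)); split.
- move=> P Pi Pm Pp Px Pl r; have [t ->] := cl_surj r.
  elim: t => [x|t IHt u IHu|t IHt|t IHt|]; first exact: Pi.
  + by rewrite -fmE; exact: Pm.
  + by rewrite -fpE; exact: Pp.
  + by rewrite -fxE; exact: Px.
  + exact: Pl.
- move=> R fR f; pose phi (c : ffr) := eval fR f (repr c).
  have phiE t : phi (cl t) = eval fR f t by exact: repr_cl.
  exists phi; last by move=> x; rewrite phiE.
  split; [split|..].
  + move=> a b; have [[t ->] [u ->]] := (cl_surj a, cl_surj b).
    by rewrite mE !phiE.
  + by move=> a; have [t ->] := cl_surj a; rewrite pE !phiE.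
  + by move=> a; have [t ->] := cl_surj a; rewrite [fmax _ _]fxE !phiE.
  + by rewrite [flam _]/= phiE.
Qed.

End FreeExists.

Section CayleyGraph.
Variables (S : monoidType) (Y : Type) (i : Y -> S).

Record graph := Graph { verts : set S; edges : set (S * Y * S) }.

Definition cayley : graph :=
  Graph setT [set e | e.2 = e.1.1 * i e.1.2].

Definition is_subgraph (G H : graph) : Prop :=
  [/\ verts G `<=` verts H, edges G `<=` edges H
    & forall s y t, edges G (s, y, t) -> verts G s /\ verts G t].

Definition adj (G : graph) (s t : S) : Prop := exists y, edges G (s, y, t).

Definition accessible (G : graph) : Prop :=
  verts G 1 /\ forall s, verts G s -> clos_refl_trans S (adj G) 1 s.

Definition finite_graph (G : graph) : Prop :=
  finite_set (verts G) /\ finite_set (edges G).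

Definition gunion (G H : graph) : graph :=
  Graph (verts G `|` verts H) (edges G `|` edges H).

Definition gtranslate (s : S) (G : graph) : graph :=
  Graph [set s * v | v in verts G]
        [set (s * e.1.1, e.1.2, s * e.2) | e in edges G].

Definition gsingle (y : Y) : graph := Graph [set 1; i y] [set (1, y, i y)].

Definition is_munn (p : graph * S) : Prop :=
  [/\ is_subgraph p.1 cayley, finite_graph p.1, accessible p.1,
      edges p.1 !=set0 & verts p.1 p.2].

Definition munn : Type := {p : graph * S | is_munn p}.

HB.instance Definition _ := gen_eqMixin munn.
HB.instance Definition _ := gen_choiceMixin munn.

Lemma munn_inj (a b : munn) : sval a = sval b -> a = b.
Proof.
case: a b => [a Ma] [b Mb] /= ab; case: _ / ab Mb => Mb.
by congr exist; exact: Prop_irrelevance.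
Qed.

Lemma graph_eq (G H : graph) : verts G = verts H -> edges G = edges H -> G = H.
Proof. by case: G H => [? ?] [? ?] /= -> ->. Qed.

Lemma clos_sub (r r' : S -> S -> Prop) (g : S -> S) s t :
    (forall a b, r a b -> r' (g a) (g b)) ->
  clos_refl_trans S r s t -> clos_refl_trans S r' (g s) (g t).
Proof.
move=> rr'; elim=> [a b /rr'|a|a b c _ ab _ bc].
- exact: rt_step.
- exact: rt_refl.
- exact: rt_trans ab bc.
Qed.

Definition munn_mul_val (a b : graph * S) : graph * S :=
  (gunion a.1 (gtranslate a.2 b.1), a.2 * b.2).

Fact munn_mul_subproof (a b : munn) : is_munn (munn_mul_val (sval a) (sval b)).
Proof.
case: a b => [[A s] /= [[sA1 sA2 sA3] [fA1 fA2] [aA1 aA2] nA vA]].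
case=> [[B t] /= [[sB1 sB2 sB3] [fB1 fB2] [aB1 aB2] nB vB]]; split=> /=.
- split=> //=.
  + move=> [[x y] z] [/sA2//|[[[x' y'] z'] /sB2 /= -> [<- <- <-]]] /=.
    by rewrite mulgA.
  + move=> x y z [/sA3[]|[[[x' y'] z'] /sB3[vx vz] [<- _ <-]]].
      by split; left.
    by split; right; [exists x'|exists z'].
- by split; rewrite finite_setU; split=> //; exact: finite_image.
- split; first by left.
  have AR u : verts A u ->
      clos_refl_trans S (adj (gunion A (gtranslate s B))) 1 u.
    move=> /aA2; apply: (@clos_sub (adj A) _ id 1 u) => x z [y xz].
    by exists y; left.
  move=> v [/AR//|[u /aB2 Bu <-]].
  apply: (@rt_trans _ _ _ s); first exact: AR.
  have := @clos_sub _ (adj (gunion A (gtranslate s B))) (mul s) _ _ _ Bu.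
  rewrite mulg1; apply=> x z [y xz].
  by exists y; right; exists (x, y, z).
- by case: nA => e Ae; exists e; left.
- by right; exists t.
Qed.

Definition munn_mul (a b : munn) : munn := exist _ _ (munn_mul_subproof a b).

Fact munn_rplus_subproof (a : munn) : is_munn ((sval a).1, 1).
Proof. by case: a => [[A s] /= [? ? [v1 ?] ? ?]]; split. Qed.

Definition munn_rplus (a : munn) : munn := exist _ _ (munn_rplus_subproof a).

Fact munn_gen_subproof (y : Y) : is_munn (gsingle y, i y).
Proof.
split=> /=.
- split=> //= [[[x z] w] [-> -> ->]|x z w [-> _ ->]] /=.
    by rewrite mul1g.
  by split; [left|right].
- by split; [exact: finite_set2|exact: finite_set1].
- split; first by left.
  by move=> v [->|->]; [exact: rt_refl|apply: rt_step; exists y].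
- by exists (1, y, i y).
- by right.
Qed.

Definition munn_gen (y : Y) : munn := exist _ _ (munn_gen_subproof y).

Lemma gtranslate1 G : gtranslate 1 G = G.
Proof.
apply: graph_eq => /=.
- by under eq_imagel do rewrite mul1g; rewrite image_id.
- apply/seteqP; split=> [_ [[[x y] z] Ge <-]|[[x y] z] Ge] /=.
    by rewrite !mul1g.
  by exists (x, y, z) => //=; rewrite !mul1g.
Qed.

Lemma gtranslateM s t G : gtranslate (s * t) G = gtranslate s (gtranslate t G).
Proof.
by apply: graph_eq => /=; rewrite image_comp; apply: eq_imagel => x _ /=;
  rewrite !mulgA.
Qed.

Lemma gtranslateU s G H :
  gtranslate s (gunion G H) = gunion (gtranslate s G) (gtranslate s H).
Proof. by apply: graph_eq => /=; rewrite image_setU. Qed.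

Lemma gunionA : associative gunion.
Proof. by move=> A B C; apply: graph_eq => /=; rewrite setUA. Qed.

Lemma gunionC : commutative gunion.
Proof. by move=> A B; apply: graph_eq => /=; rewrite setUC. Qed.

Lemma gunionid : idempotent_op gunion.
Proof. by move=> A; apply: graph_eq => /=; rewrite setUid. Qed.

Fact munn_mulA : associative munn_mul.
Proof.
move=> a b c; apply: munn_inj; rewrite /= /munn_mul_val /=.
by rewrite mulgA gtranslateU gunionA gtranslateM.
Qed.

HB.instance Definition _ := isSemigroup.Build munn munn_mulA.

Fact munn_rplus_mull (x : munn) : munn_rplus x * x = x.
Proof.
apply: munn_inj; rewrite /= /munn_mul_val /=.
by rewrite gtranslate1 gunionid mul1g; case: (sval x).
Qed.

Fact munn_rplusC (x y : munn) :
  munn_rplus x * munn_rplus y = munn_rplus y * munn_rplus x.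
Proof.
apply: munn_inj; rewrite /= /munn_mul_val /=.
by rewrite !gtranslate1 gunionC.
Qed.

Fact munn_rplus_mul (x y : munn) :
  munn_rplus (munn_rplus x * y) = munn_rplus x * munn_rplus y.
Proof. by apply: munn_inj; rewrite /= /munn_mul_val /= mulg1. Qed.

Fact munn_mul_rplus (x y : munn) :
  x * munn_rplus y = munn_rplus (x * y) * x.
Proof.
apply: munn_inj; rewrite /= /munn_mul_val /=.
by rewrite gtranslate1 mulg1 mul1g [in RHS]gunionC gunionA gunionid.
Qed.

HB.instance Definition _ := Semigroup_isRestriction.Build munn
  munn_rplus_mull munn_rplusC munn_rplus_mul munn_mul_rplus.

End CayleyGraph.

Definition words (X : Type) : Type := seq X.

Section FreeMonoid.
Variable X : Type.
HB.instance Definition _ := gen_eqMixin (words X).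
HB.instance Definition _ := gen_choiceMixin (words X).
HB.instance Definition _ :=
  isMonoid.Build (words X) (@catA X) (@cat0s X) (@cats0 X).
End FreeMonoid.

Section RhoN.
Variable X : Type.

(* [inl x] is the letter x and [inr u] is the barred word. *)
Definition letters : Type := (X + words X)%type.

Definition letters_val (y : letters) : words X :=
  match y with inl x => [:: x] | inr u => u end.

Definition MX : restrictionType := munn letters_val.

Definition gx (x : X) : MX := munn_gen letters_val (inl x).
Definition gbar (u : words X) : MX := munn_gen letters_val (inr u).

Inductive rhoN_base : MX -> MX -> Prop :=
| rhoN_lam (u : words X) : u <> 1 -> rhoN_base (gbar u) (gbar 1 * gbar u)
| rhoN_letter (x : X) : rhoN_base (gx x) (rplus (gx x) * gbar [:: x])
| rhoN_mul (u v : words X) : u <> 1 -> v <> 1 ->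
    rhoN_base (gbar u * gbar v) (rplus (gbar u * gbar v) * gbar (u * v)).

Definition rhoN : congruence MX := cgen rhoN_base.

Definition eval_word (R : semigroupType) (i : X -> R) (x : X) (u : seq X) : R :=
  foldl (fun r z => r * i z) (i x) u.

Definition letters_assign (F : restrictionType) (fF : Fstruct F) (i : X -> F)
    (y : letters) : F :=
  match y with
  | inl x => i x
  | inr [::] => flam fF
  | inr (x :: u) => fmax fF (eval_word i x u)
  end.

Definition is_canonical_kernel (F : restrictionType) (fF : Fstruct F)
    (i : X -> F) (rho : congruence MX) : Prop :=
  exists phi : MX -> F,
    [/\ restr_morphism phi,
        canonical_map (munn_gen letters_val) (letters_assign fF i) phi,
        (forall r, exists a, phi a = r)
      & forall a b, rho a b <-> phi a = phi b].

End RhoN.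

(* Main.v *)
Require Import Defs.
From mathcomp Require Import all_boot.
From Stdlib Require Import Relation_Operators Operators_Properties.
From mathcomp Require Import boolp classical_sets functions cardinality.

Set Implicit Arguments.
Unset Strict Implicit.
Unset Printing Implicit Defensive.

Import Algebra.
Local Open Scope classical_set_scope.
Local Open Scope group_scope.

(** In an F-restriction semigroup every element is [a = a^+ a^m], so an element
    is known once its projection [a^+] and its [sigma]-class are.  Applied to
    the quotient [N] of the Munn semigroup [M] by [rhoN], this suggests the
    normal form [class a = (class a)^+ * class (gbar u)], where [u] is the word
    component of [a].  The normal form holds on the generators, the first two
    families of relations being made for that, and the third family pushes it
    through products ([class_word]).  As [rhoN] preserves the word component,
    two elements of [N] are [sigma]-related exactly when their words agree
    ([sigma_class]); therefore [class (gbar u)] is the maximum of its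
    [sigma]-class, [class (gbar 1)] is the maximum projection, and [N] is an
    F-restriction semigroup, generated by the letters.

    The rest follows from the freeness of [N], which requires a morphism from
    [M] into any F-restriction semigroup [R] with a map [i : X -> R].  Write
    [m u] for the maximum above the value of the word [u] and [j y] for the
    value of the label [y].  An edge from [u] with label [y] is sent to the
    projection [(m u * j y)^+], a graph to the meet of the projections of its
    edges, and [(G, s)] to that meet times [m s].  The point is that this map
    [munn_eval] is multiplicative.  Its behaviour under translation is
    [m s * munn_eval (B, t) = graph_proj s B * m (s * t)] ([wmax_munn_eval]),
    where [graph_proj s B] is the meet attached to the translate of [B] by [s].
    This identity is false for a general pair of a graph and a vertex, already
    because [m s * m t] may lie strictly below [m (s * t)]; accessibility has
    to be used.  It enters only through the induction principle [munn_ind]: the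
    semigroup [M] is generated by its one-edge graphs under product and [^+].

    The map [munn_eval] identifies the pairs generating [rhoN], so it factors
    through [N], and [N] is free.  Two free objects are canonically isomorphic;
    hence the factored map is bijective when [R] is free, which says that the
    kernel of [munn_eval] is [rhoN].  By [munn_ind] again, it is the only
    canonical morphism from [M], and the three conclusions follow. *)

(** * Restriction and F-restriction semigroups *)

Section Restriction.
Variable R : restrictionType.
Implicit Types a b e f : R.

Lemma rplus_mulr a b : rplus (a * rplus b) = rplus (a * b).
Proof. by rewrite mul_rplus rplus_mul rplusC -rplus_mul mulgA rplus_mull. Qed.

Lemma rplus_mul_le a b : rplus (a * b) * rplus a = rplus (a * b).
Proof. by rewrite rplusC -rplus_mul mulgA rplus_mull. Qed.

Lemma sigma_mul_proj e a : projections e -> sigma R (e * a) a.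
Proof. by move=> Pe; apply/sigmaP; exists e; rewrite // mulgA proj_idem. Qed.

Lemma sigma_mulr_proj a e : projections e -> sigma R (a * e) a.
Proof.
by move=> /projP <-; rewrite mul_rplus; apply/sigma_mul_proj/proj_rplus.
Qed.

Lemma sigma_projs e f : projections e -> projections f -> sigma R e f.
Proof. by move=> Pe Pf; apply: cgen_base. Qed.

End Restriction.

Section FTheory.
Variables (R : restrictionType) (fR : Fstruct R).
Implicit Types a b e f : R.

Lemma proj_flam : projections (flam fR).
Proof. by case: (flamP fR). Qed.

Lemma rplus_flam a : rplus a * flam fR = rplus a.
Proof.
by have /nleP := (flamP fR).2 _ (proj_rplus a); rewrite rplus_id => <-.
Qed.

Lemma flam_mull a : flam fR * a = a.
Proof.
rewrite -{1}(rplus_mull a) mulgA (projC proj_flam (proj_rplus a)).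
by rewrite rplus_flam rplus_mull.
Qed.

Lemma fmax_eq a b : sigma R a b -> fmax fR a = fmax fR b.
Proof.
move=> ab; have [? ma] := fmaxP fR a; have [? mb] := fmaxP fR b.
apply: nle_anti; [apply: mb|apply: ma].
- exact: (crel_trans (crel_sym ab)).
- exact: (crel_trans ab).
Qed.

Lemma rplus_fmax a : rplus a * fmax fR a = a.
Proof. by symmetry; apply/nleP; apply: (fmaxP fR a).2; exact: crel_refl. Qed.

(** The maximum above [flam] equals [flam]: it lies above the projection [flam],
    and [flam] is a left identity. *)
Lemma fmax_proj e : projections e -> fmax fR e = flam fR.
Proof.
move=> Pe; rewrite (fmax_eq (sigma_projs Pe proj_flam)).
have := rplus_fmax (flam fR).
by have /projP -> := proj_flam; rewrite flam_mull.
Qed.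
End FTheory.

(** * Generation of the Munn semigroup by its one-edge graphs *)

Section MunnGeneration.
Variables (S : monoidType) (Y : Type) (i : Y -> S).
Notation M := (munn i).

Lemma munn_mul2 (a b : M) : (sval (a * b)).2 = (sval a).2 * (sval b).2.
Proof. by []. Qed.

Lemma munn_rplus_mulE (a b : M) :
  sval (rplus a * b) = (gunion (sval a).1 (sval b).1, (sval b).2).
Proof. by rewrite /= /munn_mul_val /= gtranslate1 mul1g. Qed.

(** Every vertex of an accessible graph other than [1] ends a path in the graph,
    and the product of the generators along this path is an element whose graph
    is contained in the given one.  The product of the projections of such
    elements, one for each edge, recovers the graph; a last factor along a path
    to the distinguished vertex [s] recovers the pair.  The empty path has no
    value in the semigroup, hence the separate treatment of [1]. *)
Lemma munn_ind (P : M -> Prop) :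
    (forall y, P (munn_gen i y)) ->
    (forall a b, P a -> P b -> P (a * b)) ->
    (forall a, P a -> P (rplus a)) ->
  forall a, P a.
Proof.
move=> Pgen Pmul Pplus [[G s] /= GP].
have [/= [_ Gcay Gend] [_ Gfin] [_ Gacc] [e0 Ge0] Gs] := GP.
pose inG (b : M) :=
  verts (sval b).1 `<=` verts G /\ edges (sval b).1 `<=` edges G.
pose pathto v := exists w : M, [/\ P w, inG w & (sval w).2 = v].
have pathS v y z : v = 1 \/ pathto v -> edges G (v, y, z) ->
    exists w : M, [/\ P w, inG w, (sval w).2 = z & edges (sval w).1 (v, y, z)].
  move=> vP Gvyz; have /= zE := Gcay _ Gvyz; have [/= Gv Gz] := Gend _ _ _ Gvyz.
  case: vP => [v1|[w [Pw [wv we] wE]]].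
    exists (munn_gen i y); move: zE; rewrite v1 mul1g => zE; subst v z.
    by split=> //; split=> [u [->|->]|u ->].
  exists (w * munn_gen i y); split=> /=.
  - exact: Pmul.
  - rewrite /inG /= wE; split=> [u [/wv//|[_ [->|->] <-]]|u [/we//|[_ -> <-]]].
    + by rewrite mulg1.
    + by rewrite -zE.
    + by rewrite /= mulg1 -zE.
  - by rewrite wE.
  - by right; exists (1, y, i y) => //=; rewrite wE mulg1 -zE.
have reach v : verts G v -> v = 1 \/ pathto v.
  move=> /Gacc /clos_rt_rtn1_iff; elim=> [|u z [y uyz] _ IH]; first by left.
  by have [w [? ? ? _]] := pathS _ _ _ IH uyz; right; exists w.
have edgeP e : edges G e ->
    exists w : M, [/\ P w, inG w & edges (sval w).1 e].
  case: e => [[u y] z] Ge; have [Gu _] := Gend _ _ _ Ge.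
  by have [w [? ? ? ?]] := pathS _ _ _ (reach _ Gu) Ge; exists w.
(* The projections of the elements found for the edges multiply up to a
   projection [a] with graph [G]. *)
have [L LE] := (@finite_seqP {classic (S * Y * S)} (edges G)).1 Gfin.
have [a [Pa [av ae] a1 La]] : exists a : M,
    [/\ P a, inG a, (sval a).2 = 1 & forall e, e \in L -> edges (sval a).1 e].
  have : forall e, e \in L -> edges G e by move=> e eL; rewrite LE.
  elim: L {LE} => [_|e L IH LG].
    by have [w [Pw wG _]] := edgeP _ Ge0; exists (rplus w); split=> //; apply: Pplus.
  have [|a [Pa [av ae] a1 La]] := IH.
    by move=> f fL; apply: LG; rewrite inE fL orbT.
  have [|w [Pw [wv we] eE]] := edgeP e; first by apply: LG; rewrite inE eqxx.
  exists (rplus w * a); rewrite /inG munn_rplus_mulE; split=> //=.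
  - by apply: Pmul => //; apply: Pplus.
  - by split; rewrite subUset.
  - by move=> f; rewrite inE => /orP[/eqP->|/La]; [left|right].
(* No vertex is missed: each is [1] or the end of an edge. *)
have aE : (sval a).1 = G.
  have aGe : edges G `<=` edges (sval a).1 by move=> e; rewrite {1}LE => /La.
  have [[_ _ aend] _ [av1 _] _ _] := svalP a.
  apply: graph_eq; apply/seteqP; split=> //.
  move=> v /Gacc /clos_rt_rtn1_iff; case=> [//|u z [y uyz] _].
  by have [] := aend _ _ _ (aGe _ uyz).
have [s1|[w [Pw [wv we] ws]]] := reach _ Gs.
  rewrite (_ : exist _ _ _ = a) //; apply: munn_inj => /=.
  by rewrite s1 -a1 -aE; case: (sval a).
rewrite (_ : exist _ _ _ = a * w); first exact: Pmul.
apply: munn_inj; rewrite /= /munn_mul_val a1 ws mul1g gtranslate1 aE.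
congr pair; apply: graph_eq => /=; exact/esym/setUidPl.
Qed.

End MunnGeneration.

(** * Finite meets of projections *)

Section Meets.
Variables (R : restrictionType) (fR : Fstruct R).
Implicit Types (e f g : R) (E F : set R).

(** The greatest lower bound among the projections, [g * e = g] being [g <= e].
    Characterizing finite meets by this property, instead of by a product over
    an enumeration, makes the meet of a union a product without any bookkeeping
    of repetitions. *)
Definition is_meet E e : Prop :=
  projections e /\
  forall g, projections g -> (g * e = g <-> forall f, E f -> g * f = g).

Definition pmeet E : R := xget (flam fR) (is_meet E).

Lemma proj_le_mul e f g : projections e -> projections f ->
  g * (e * f) = g <-> g * e = g /\ g * f = g.
Proof.
move=> Pe Pf; split=> [gef|[ge gf]]; last by rewrite mulgA ge.
by split; rewrite -{1}gef -!mulgA;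
  [rewrite (projC Pf Pe) (mulgA e e) (proj_idem Pe) | rewrite (proj_idem Pf)].
Qed.

Lemma is_meet_uniq E e f : is_meet E e -> is_meet E f -> e = f.
Proof.
move=> [Pe eE] [Pf fE].
have ef : e * f = e by apply/(fE _ Pe)/(eE _ Pe)/proj_idem.
have fe : f * e = f by apply/(eE _ Pf)/(fE _ Pf)/proj_idem.
by rewrite -ef projC.
Qed.

Lemma is_meet0 : is_meet set0 (flam fR).
Proof.
by split=> [|g /projP <-]; [exact: proj_flam | rewrite rplus_flam].
Qed.

Lemma is_meet1 e : projections e -> is_meet [set e] e.
Proof. by move=> Pe; split=> // g Pg; split=> [ge f -> //|]; apply. Qed.

Lemma is_meetU E F e f :
  is_meet E e -> is_meet F f -> is_meet (E `|` F) (e * f).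
Proof.
move=> [Pe eE] [Pf fF]; split=> [|g Pg]; first exact: projM.
rewrite (proj_le_mul _ Pe Pf) (eE _ Pg) (fF _ Pg).
split=> [[gE gF] h [/gE|/gF] //|gEF].
by split=> h Eh; apply: gEF; [left|right].
Qed.

Lemma pmeetP E : finite_set E -> E `<=` @projections R -> is_meet E (pmeet E).
Proof.
move=> /finite_seqP[L ->] LP; apply: xgetPex.
elim: L LP => [_|f L IH LP].
  by exists (flam fR); rewrite set_nil; exact: is_meet0.
have [g gL|e eL] := IH; first by apply: LP; rewrite /= inE gL orbT.
exists (f * e).
have -> : [set` f :: L] = [set f] `|` [set` L].
  by apply/seteqP; split=> x /=; rewrite inE => /predU1P.
apply: is_meetU => //; apply: is_meet1.
by apply: LP; rewrite /= inE eqxx.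
Qed.

Lemma pmeet_eq E e : is_meet E e -> pmeet E = e.
Proof. by move=> eE; apply: is_meet_uniq (eE); apply: xgetPex; exists e. Qed.

End Meets.

(** * Evaluation of Munn pairs in an F-restriction semigroup *)

Section Evaluation.
Variables (X : Type) (R : restrictionType) (fR : Fstruct R) (i : X -> R).
Notation M := (MX X).
Notation val := (@letters_val X).
Local Notation j := (letters_assign fR i).

Definition wmax (u : words X) : R := j (inr u).

Lemma foldl_mulg a b (u : seq X) :
  foldl (fun r z => r * i z) (a * b) u = a * foldl (fun r z => r * i z) b u.
Proof. by elim: u b => //= z u IH b; rewrite -mulgA IH. Qed.

Lemma eval_word_cat x y u v :
  eval_word i x (u ++ y :: v) = eval_word i x u * eval_word i y v.
Proof. by rewrite /eval_word foldl_cat /= foldl_mulg. Qed.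

Lemma wmax_mul u v : sigma R (wmax u * wmax v) (wmax (u * v)).
Proof.
case: u => [|x u]; first by rewrite [wmax [::]]/= flam_mull; exact: crel_refl.
case: v => [|y v].
  by rewrite mulg1; apply/sigma_mulr_proj/proj_flam.
have sm z w : sigma R (eval_word i z w) (wmax (z :: w)) := (fmaxP fR _).1.
have -> : (x :: u : words X) * (y :: v) = x :: (u ++ y :: v) by [].
apply: crel_trans (sm _ _); rewrite eval_word_cat.
by apply: crel_mul; apply: crel_sym.
Qed.

Lemma sigma_letter y : sigma R (j y) (wmax (val y)).
Proof.
by case: y => [x|u]; [exact: (fmaxP fR (i x)).1 | exact: crel_refl].
Qed.

Lemma fmax_wmax u : fmax fR (wmax u) = wmax u.
Proof.
case: u => [|x u]; first exact/fmax_proj/proj_flam.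
by symmetry; exact/fmax_eq/(fmaxP fR _).1.
Qed.

Lemma rplus_wmax a u : sigma R a (wmax u) -> rplus a * wmax u = a.
Proof. by move=> /fmax_eq E; rewrite -{1}fmax_wmax -E rplus_fmax. Qed.

(** One step along an edge: below the projection of the edge from [s] with label
    [y], multiplying [wmax s] by the value of [y] leads to the maximum attached
    to the target vertex. *)
Lemma wmax_letter s y :
  rplus (wmax s * j y) * wmax (s * val y) = wmax s * j y.
Proof.
apply: rplus_wmax; apply: crel_trans (wmax_mul _ _).
exact: crel_mul (crel_refl _ _) (sigma_letter _).
Qed.

Definition edge_proj s (e : words X * letters X * words X) : R :=
  rplus (wmax (s * e.1.1) * j e.1.2).

(** The meet of the projections of the edges of the translate of [G] by [s];
    keeping [s] as a parameter avoids forming the translated graph. *)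
Definition graph_proj s (G : graph (words X) (letters X)) : R :=
  pmeet fR (edge_proj s @` edges G).

Lemma graph_projP s G : finite_set (edges G) ->
  is_meet (edge_proj s @` edges G) (graph_proj s G).
Proof.
move=> Gfin; apply: pmeetP; first exact: finite_image.
by move=> _ [e _ <-]; exact: proj_rplus.
Qed.

Lemma munn_fin (a : M) : finite_set (edges (sval a).1).
Proof. by case: (svalP a) => _ []. Qed.

Lemma proj_graph_proj s (a : M) : projections (graph_proj s (sval a).1).
Proof. by case: (graph_projP s (munn_fin a)). Qed.

Lemma graph_proj_gen s y :
  graph_proj s (gsingle val y) = rplus (wmax s * j y).
Proof.
apply: pmeet_eq; rewrite /gsingle /= image_set1 /edge_proj /= mulg1.
exact/is_meet1/proj_rplus.
Qed.

Lemma graph_proj_mul s (a b : M) :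
  graph_proj s (sval (a * b)).1
    = graph_proj s (sval a).1 * graph_proj (s * (sval a).2) (sval b).1.
Proof.
apply: pmeet_eq; rewrite /= image_setU.
apply: is_meetU (graph_projP _ (munn_fin a)) _.
rewrite image_comp (eq_imagel (f' := edge_proj (s * (sval a).2))).
  exact: graph_projP (munn_fin b).
by move=> e _; rewrite /= /edge_proj /= mulgA.
Qed.

(** The projection of a graph lies below [(wmax v)^+] for both the root [v = s]
    and the distinguished vertex [v = s * (sval a).2] of the translated pair:
    an edge projection lies below those of its two ends, and vertices are
    reached along edges. *)
Lemma graph_proj_le (a : M) s :
  graph_proj s (sval a).1 * rplus (wmax s) = graph_proj s (sval a).1 /\
  graph_proj s (sval a).1 * rplus (wmax (s * (sval a).2))
    = graph_proj s (sval a).1.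
Proof.
elim/munn_ind: a s => [y|a b IHa IHb|a IHa] s.
- rewrite graph_proj_gen /=; split; first exact: rplus_mul_le.
  by rewrite -rplus_mul wmax_letter.
- have [Ha _] := IHa s; have [_ Hb] := IHb (s * (sval a).2).
  rewrite graph_proj_mul; split; last by rewrite munn_mul2 (mulgA s) -(mulgA (graph_proj s _)) Hb.
  have Pb := proj_graph_proj (s * (sval a).2) b.
  by rewrite -mulgA (projC Pb (proj_rplus _)) mulgA Ha.
- by have [Ha _] := IHa s; rewrite /= mulg1.
Qed.

Definition munn_eval (a : M) : R := graph_proj 1 (sval a).1 * wmax (sval a).2.

Lemma munn_eval_gen : canonical_map (munn_gen val) j munn_eval.
Proof.
move=> y; have flamE b : wmax 1 * b = b by exact: flam_mull.
by rewrite /munn_eval graph_proj_gen /= flamE (rplus_wmax (sigma_letter y)).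
Qed.

Lemma munn_eval_rplus : {morph munn_eval : a / rplus a}.
Proof.
move=> a; have Pa := proj_graph_proj 1 a.
rewrite /munn_eval proj_mul //= -[in RHS](mul1g (sval a).2).
rewrite (graph_proj_le a 1).2; have /projP <- := Pa; exact: rplus_flam.
Qed.

(** Left multiplication by a maximum translates the graph.  For a single edge
    this is [wmax_letter]; for a product, the induction hypothesis on the right
    factor is what makes [munn_eval] multiplicative there, and the two
    translations compose; for a projection, [x * y^+ = (x * y)^+ * x] moves
    [wmax s] across. *)
Lemma wmax_munn_eval (a : M) s :
  wmax s * munn_eval a = graph_proj s (sval a).1 * wmax (s * (sval a).2).
Proof.
elim/munn_ind: a s => [y|a b IHa IHb|a IHa] s.
- by rewrite munn_eval_gen graph_proj_gen wmax_letter.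
- have evalM : munn_eval (a * b) = munn_eval a * munn_eval b.
    by rewrite /munn_eval -[RHS]mulgA IHb mulgA -graph_proj_mul.
  rewrite evalM mulgA IHa -mulgA IHb graph_proj_mul.
  by rewrite munn_mul2 -[RHS]mulgA (mulgA s).
- rewrite munn_eval_rplus mul_rplus IHa proj_mul; last exact: proj_graph_proj.
  by rewrite (graph_proj_le a s).2 /= mulg1.
Qed.

Lemma munn_evalM : {morph munn_eval : a b / a * b}.
Proof.
move=> a b; rewrite /munn_eval -[RHS]mulgA wmax_munn_eval.
by rewrite mulgA -graph_proj_mul.
Qed.

End Evaluation.

(** * Morphisms determined by generators *)

Section Morphisms.

Lemma munn_morphism_eq (S : monoidType) (Y : Type) (i : Y -> S)
    (R : restrictionType) (phi psi : munn i -> R) :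
    restr_morphism phi -> restr_morphism psi ->
    (forall y, phi (munn_gen i y) = psi (munn_gen i y)) ->
  phi =1 psi.
Proof.
move=> [phiM phiP] [psiM psiP] gens; elim/munn_ind => // [a b IHa IHb|a IHa].
- by rewrite phiM psiM IHa IHb.
- by rewrite phiP psiP IHa.
Qed.

Lemma F_morphism_eq (Y : Type) (A B : restrictionType) (fA : Fstruct A)
    (fB : Fstruct B) (iA : Y -> A) (phi psi : A -> B) :
    F_generated fA iA -> F_morphism fA fB phi -> F_morphism fA fB psi ->
    (forall y, phi (iA y) = psi (iA y)) ->
  phi =1 psi.
Proof.
move=> genA [[phiM phiP] phiX phiL] [[psiM psiP] psiX psiL] gens.
apply: (genA [set a | phi a = psi a]) => //= [a b IHa IHb|a IHa|a IHa|].
- by rewrite phiM psiM IHa IHb.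
- by rewrite phiP psiP IHa.
- by rewrite phiX psiX IHa.
- by rewrite phiL psiL.
Qed.

Lemma F_morphism_comp (A B C : restrictionType) (fA : Fstruct A)
    (fB : Fstruct B) (fC : Fstruct C) (phi : A -> B) (psi : B -> C) :
  F_morphism fA fB phi -> F_morphism fB fC psi ->
  F_morphism fA fC (psi \o phi).
Proof.
move=> [[phiM phiP] phiX phiL] [[psiM psiP] psiX psiL].
split; [split=> [a b|a]|move=> a|] => /=.
- by rewrite phiM psiM.
- by rewrite phiP psiP.
- by rewrite phiX psiX.
- by rewrite phiL psiL.
Qed.

Lemma free_F_bij (Y : Type) (A B : restrictionType) (fA : Fstruct A)
    (fB : Fstruct B) (iA : Y -> A) (iB : Y -> B) (phi : A -> B) :
    is_free_F fA iA -> is_free_F fB iB ->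
    F_morphism fA fB phi -> canonical_map iA iB phi ->
  bijective phi.
Proof.
move=> [genA _] [genB freeB] phiF phiY.
have [psi psiF psiY] := freeB A fA iA.
have idF C (fC : Fstruct C) : F_morphism fC fC id by [].
exists psi => c.
- apply: (F_morphism_eq genA (F_morphism_comp phiF psiF) (idF _ fA)) => y /=.
  by rewrite phiY psiY.
- apply: (F_morphism_eq genB (F_morphism_comp psiF phiF) (idF _ fB)) => y /=.
  by rewrite psiY phiY.
Qed.

Variables (R T : restrictionType) (phi : R -> T) (phiM : restr_morphism phi).

Definition kernel : congruence R.
Proof.
exists (fun a b => phi a = phi b) => //; case: phiM => pM pP.
- by move=> a b c ->.
- by move=> a a' b b' aa bb; rewrite !pM aa bb.
- by move=> a a' aa; rewrite !pP aa.
Defined.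

Lemma cgen_kernel (B : R -> R -> Prop) a b :
  (forall x y, B x y -> phi x = phi y) -> cgen B a b -> phi a = phi b.
Proof. by move=> BR ab; apply: (ab kernel). Qed.

End Morphisms.

(** * The quotient by [rhoN] is a free F-restriction semigroup *)

Section QuotientN.
Variable X : Type.
Notation M := (MX X).
Notation val := (@letters_val X).
Notation rhoN := (rhoN X).
Notation N := (quot rhoN).
Notation cl := (class rhoN).
Notation word a := (sval a).2.

Definition word_congruence : congruence M.
Proof.
exists (fun a b : M => word a = word b) => //.
- by move=> a b c ->.
- by move=> a a' b b' aa bb; rewrite !munn_mul2 aa bb.
Defined.

Lemma rhoN_word (a b : M) : rhoN a b -> word a = word b.
Proof.
by move=> ab; apply: (ab word_congruence) => _ _ [u _|x|u v _ _] /=;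
  rewrite mul1g.
Qed.

Lemma proj_gbar1 : projections (gbar (1 : words X)).
Proof. by apply/projP; exact: munn_inj. Qed.

Lemma proj_class_gbar1 : projections (cl (gbar 1)).
Proof. by apply/projP; rewrite -class_rplus; have /projP -> := proj_gbar1. Qed.

(** The relation for [gx x] is what gives the case of a letter:
    [x = x^+ * gbar x], and [gbar 1], being a projection, commutes with [x^+]
    and is then absorbed by [gbar x]. *)
Lemma gbar1_mull (a : M) : cl (gbar 1) * cl a = cl a.
Proof.
rewrite -classM; elim/munn_ind: a => [[x|u]|a b IHa _|a IHa].
- have xE : cl (gx x) = cl (rplus (gx x) * gbar [:: x]).
    exact/classP/cgen_base/rhoN_letter.
  have barE : cl (gbar 1 * gbar [:: x]) = cl (gbar [:: x]).
    by apply/esym/classP/cgen_base/rhoN_lam.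
  rewrite classM -/(gx x) xE -classM mulgA (projC proj_gbar1 (proj_rplus _)).
  by rewrite -mulgA [LHS]classM barE -classM.
- case: u => [|x u]; first by rewrite (proj_idem proj_gbar1).
  by apply/esym/classP/cgen_base/rhoN_lam.
- by rewrite mulgA classM IHa -classM.
- by rewrite -(proj_mul _ proj_gbar1) class_rplus IHa -class_rplus.
Qed.

(** The third family of relations extended to empty words.  For [u = 1] this is
    because [gbar 1] is a left identity, while for [v = 1] the law
    [x * e = (x * e)^+ * x] suffices, [gbar 1] not being a right identity. *)
Lemma gbar_mul (u v : words X) :
  cl (gbar u) * cl (gbar v)
    = rplus (cl (gbar u) * cl (gbar v)) * cl (gbar (u * v)).
Proof.
have [->|u1] := pselect (u = 1); first by
  rewrite gbar1_mull mul1g rplus_mull.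
have [->|v1] := pselect (v = 1).
  have /projP e1 := proj_gbar1.
  by rewrite mulg1 -{1}e1 class_rplus mul_rplus.
have uvE : cl (gbar u * gbar v) = cl (rplus (gbar u * gbar v) * gbar (u * v)).
  exact/classP/cgen_base/(rhoN_mul u1 v1).
by move: uvE; rewrite classM (classM _ (rplus _)) class_rplus classM.
Qed.

(** The normal form.  In a product of [e * p] and [f * q] with [e], [f]
    projections and [p], [q] barred words, [f] moves to the left of [p] as a
    projection, and [p * q] is a projection times a barred word. *)
Lemma class_word (a : M) : cl a = rplus (cl a) * cl (gbar (word a)).
Proof.
apply/nleP; elim/munn_ind: a => [[x|u]|a b /nleP IHa /nleP IHb|a _].
- exists (rplus (cl (gx x))); first exact: proj_rplus.
  by rewrite -class_rplus -classM; apply/classP/cgen_base/rhoN_letter.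
- by apply/nleP; rewrite rplus_mull.
- rewrite classM IHa IHb munn_mul2.
  set e := rplus (cl a); set f := rplus (cl b).
  set p := cl (gbar (word a)); set q := cl (gbar (word b)).
  exists (e * (rplus (p * cl b) * rplus (p * q))).
    by apply: projM; [|apply: projM]; exact: proj_rplus.
  have pfE : p * f = rplus (p * cl b) * p := mul_rplus p (cl b).
  have pqE : p * q = rplus (p * q) * cl (gbar (word a * word b)) := gbar_mul _ _.
  by rewrite -!mulgA -pqE (mulgA p f) pfE -(mulgA (rplus _) p q).
- exists (rplus (cl a)); first exact: proj_rplus.
  rewrite class_rplus [word _]/= (projC (proj_rplus _) proj_class_gbar1).
  by rewrite -class_rplus gbar1_mull.
Qed.

Lemma sigma_class (a b : M) : sigma N (cl a) (cl b) <-> word a = word b.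
Proof.
split=> [/sigmaP[_ [c _ <-]]|ab].
  have [{}c ->] := class_surj c; rewrite -class_rplus -!classM.
  by move=> /classP/rhoN_word; rewrite !munn_mul2 /= !mul1g.
have bar c : sigma N (cl c) (cl (gbar (word c))).
  by rewrite class_word; apply/sigma_mul_proj/proj_rplus.
by apply: crel_trans (bar a) _; rewrite ab; apply: crel_sym.
Qed.

(** Independent of the representative, by [rhoN_word]. *)
Definition maxN (c : N) : N := cl (gbar (word (repr c))).

Lemma maxN_class (a : M) : maxN (cl a) = cl (gbar (word a)).
Proof. by rewrite /maxN (rhoN_word (repr_class rhoN a)). Qed.

Lemma maxNP (c : N) : is_maximum (sigma N c) (maxN c).
Proof.
have [a ->] := class_surj c; rewrite maxN_class; split.
  exact/sigma_class.
move=> t; have [b ->] := class_surj t; move=> /sigma_class ->.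
exact/nleP/class_word.
Qed.

Lemma lamNP : is_maximum (@projections N) (cl (gbar 1)).
Proof.
split=> [|e Pe]; first exact: proj_class_gbar1.
exists e => //; have [a eE] := class_surj e.
by rewrite (projC Pe proj_class_gbar1) eE gbar1_mull.
Qed.

Definition fN : Fstruct N := FStruct maxNP lamNP.

Notation iN := (fun x : X => cl (gx x)).

Lemma eval_word_gx x (u : words X) :
  exists2 a : M, eval_word iN x u = cl a & word a = x :: u.
Proof.
rewrite /eval_word; have : word (gx x) = [:: x] by [].
move: (gx x) [:: x] (cat1s x u) => a v <-.
elim: u a v => [|z u IH] a v aE /=; first by exists a; rewrite ?cats0.
rewrite -classM -cat1s catA; apply: IH.
by rewrite munn_mul2 aE.
Qed.

Lemma fN_generated : F_generated fN iN.
Proof.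
move=> P Pi PM Pp Px Pl c; have [a ->] := class_surj c.
elim/munn_ind: a => [[x|[|x u]]|a b Pa Pb|a Pa].
- exact: Pi.
- exact: Pl.
- have [a aE wa] := eval_word_gx x u.
  have -> : cl (munn_gen val (inr (x :: u))) = fmax fN (eval_word iN x u).
    by rewrite aE [fmax _ _]maxN_class wa.
  apply: Px; rewrite /eval_word; elim: u (iN x) (Pi x) {aE wa} => //= z u IH b Pb.
  exact/IH/PM.
- by rewrite classM; exact: PM.
- by rewrite class_rplus; exact: Pp.
Qed.

Section FreeProperty.
Variables (R : restrictionType) (fR : Fstruct R) (i : X -> R).
Local Notation eval := (munn_eval fR i).

Lemma munn_eval_morphism : restr_morphism eval.
Proof. by split; [exact: munn_evalM|exact: munn_eval_rplus]. Qed.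

Lemma rhoN_eval (a b : M) : rhoN a b -> eval a = eval b.
Proof.
apply: (cgen_kernel munn_eval_morphism) => {a b} _ _ [u _|x|u v _ _].
- by rewrite munn_evalM !munn_eval_gen /= flam_mull.
- rewrite munn_evalM munn_eval_rplus !munn_eval_gen.
  by rewrite [RHS](rplus_wmax (sigma_letter fR i (inl x))).
- rewrite !munn_evalM munn_eval_rplus munn_evalM !munn_eval_gen.
  by rewrite [RHS](rplus_wmax (wmax_mul fR i u v)).
Qed.

Definition quot_eval (c : N) : R := eval (repr c).

Lemma quot_evalE a : quot_eval (cl a) = eval a.
Proof. exact/rhoN_eval/repr_class. Qed.

Lemma quot_eval_morphism : F_morphism fN fR quot_eval.
Proof.
split; [split=> [c d|c]|move=> c|].
- have [[a ->] [b ->]] := (class_surj c, class_surj d).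
  by rewrite -classM !quot_evalE munn_evalM.
- have [a ->] := class_surj c.
  by rewrite -class_rplus !quot_evalE munn_eval_rplus.
- have [a ->] := class_surj c.
  rewrite [fmax fN _]maxN_class !quot_evalE munn_eval_gen -[LHS]fmax_wmax.
  by apply/fmax_eq/crel_sym/sigma_mul_proj/proj_graph_proj.
- by rewrite quot_evalE munn_eval_gen.
Qed.

Lemma quot_eval_canonical : canonical_map iN i quot_eval.
Proof. by move=> x; rewrite quot_evalE munn_eval_gen. Qed.

End FreeProperty.

Lemma fN_free : is_free_F fN iN.
Proof.
split=> [|R fR f]; first exact: fN_generated.
exists (quot_eval fR f); first exact: quot_eval_morphism.
exact: quot_eval_canonical.
Qed.

End QuotientN.

Theorem proposition4p5 (X : Type) (X_nonempty : inhabited X) :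
  exists fN : Fstruct (quot (rhoN X)),
    F_generated fN (fun x : X => class (rhoN X) (gx x)) /\
    forall (FFR : restrictionType) (fF : Fstruct FFR) (i : X -> FFR),
      is_free_F fF i ->
      [/\ forall rho : congruence (MX X),
            is_canonical_kernel fF i rho <->
            (forall a b, rho a b <-> rhoN X a b),
          forall rho : congruence (MX X),
            canon_iso (fun y => class rho (munn_gen (@letters_val X) y))
                      (letters_assign fF i) <->
            (forall a b, rho a b <-> rhoN X a b)
        & F_canon_iso fN fF (fun x : X => class (rhoN X) (gx x)) i].
Proof.
exists (fN X); split=> [|F fF i Ffree]; first exact: fN_generated.
have evalF := quot_eval_morphism fF i.
have eval_bij : bijective (quot_eval fF i).
  exact: free_F_bij (fN_free X) Ffree evalF (quot_eval_canonical fF i).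
have eval_ker a b : rhoN X a b <-> munn_eval fF i a = munn_eval fF i b.
  by rewrite -!quot_evalE -classP; split=> [->|/(bij_inj eval_bij)].
have eval_surj r : exists a, munn_eval fF i a = r.
  have [g _ gK] := eval_bij; exists (repr (g r)); exact: gK.
have kernelP rho :
    is_canonical_kernel fF i rho <-> forall a b, rho a b <-> rhoN X a b.
  split=> [[phi [phiM phiY _ phiK]] a b|rhoE].
    have phiE : phi =1 munn_eval fF i.
      apply: (munn_morphism_eq phiM (munn_eval_morphism fF i)) => y.
      by rewrite phiY munn_eval_gen.
    by rewrite phiK !phiE eval_ker.
  exists (munn_eval fF i); split=> //.
  - exact: munn_eval_morphism.
  - exact: munn_eval_gen.
  - by move=> a b; rewrite rhoE.
split=> // [rho|]; last first.
  by exists (quot_eval fF i); split=> //; exact: quot_eval_canonical.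
rewrite -kernelP; split=> [[phi [[phiM phiP] phi_bij phiY]]|].
  exists (phi \o class rho); split=> /=.
  - by split=> [a b|a] /=; rewrite ?classM ?class_rplus.
  - exact: phiY.
  - move=> r; have [g _ gK] := phi_bij; have [a aE] := class_surj (g r).
    by exists a; rewrite /= -aE.
  - by move=> a b; rewrite -classP; split=> [->|/(bij_inj phi_bij)].
move=> [phi [[phiM phiP] phiY phi_surj phiK]].
have reprE a : phi (repr (class rho a)) = phi a by exact/phiK/repr_class.
exists (phi \o repr); split=> [|| y /=]; last by rewrite reprE.
  split=> [c d|c] /=; have [a ->] := class_surj c.
    by have [b ->] := class_surj d; rewrite -classM !reprE phiM.
  by rewrite -class_rplus !reprE phiP.
have [h hK] := choice phi_surj; exists (class rho \o h) => [c|r] /=.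
  have [a ->] := class_surj c; apply/classP/phiK.
  by rewrite hK reprE.
by rewrite reprE.
Qed.
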